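(* Suppose that $\mathbf q=(q_k)_{k\in\mathbb N}\in\mathcal Q^+$ is given by $q_k=\frac{c^{k-1}d(1-c)^2}{(1-c^kd)^2}$ with some $c,d\in[0,1)$, $d>0$. Then, for any $k\in\mathbb N$ and $0\le\ell\le k$, $$v^{\mathrm{eff}}_{k-\ell}(\theta^\ell\mathbf q)=(k-\ell)\frac{1+c^\ell d}{1-c^\ell d}-\frac{2c^\ell d(1+c)(1-c^{k-\ell})}{(1-c)(1-c^\ell d)(1+c^kd)},$$ with the convention $v^{\mathrm{eff}}_0(\theta^k\mathbf q):=0$.
   Context: $\mathbb N=\{1,2,\dots\}$, $0^0=1$, and $\theta$ is the shift $(\theta^\ell\mathbf q)_j=q_{j+\ell}$. **Box-ball dynamics.** $\Omega=\{\eta\in\{0,1\}^{\mathbb Z}:\lim_{x\to\infty}\frac1x\sum_{y=-x}^{0}\eta(y)<\frac12\}$. A site $x$ is a record of $\eta$ if $\sum_{y=z}^{x}(2\eta(y)-1)<0$ for all $z\le x$. $(s_\infty(\eta,i))_{i\in\mathbb Z}$ enumerates the records increasingly, $s_\infty(\eta,0)$ being the largest record $\le0$ ($s_\infty(\eta,i)=\infty$ if there are too few records on the right). $\Omega_*=\{\eta\in\Omega:|s_\infty(\eta,i)|<\infty\ \forall i\}$. The carrier $W_\infty(\eta,\cdot):\mathbb Z\to\mathbb Z_{\ge0}$ is $0$ at records and satisfies $W_\infty(\eta,x)=W_\infty(\eta,x-1)+1$ if $\eta(x)=1$ and $W_\infty(\eta,x)=\max(W_\infty(\eta,x-1)-1,0)$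 if $\eta(x)=0$. The time evolution is $T\eta(x)=\eta(x)+W_\infty(\eta,x-1)-W_\infty(\eta,x)$. **Solitons (Takahashi–Satsuma algorithm).** Let $\eta\in\Omega_*$. In each word $(\eta(x):s_\infty(\eta,i)<x<s_\infty(\eta,i+1))$ repeat until nothing remains: select the leftmost run of consecutive equal letters such that the following run is at least as long; if its length is $k$, the $k$ sites of this run and the first $k$ sites of the following run form a $k$-soliton; delete these $2k$ sites. **Excursions.** An excursion of length $2n+1$, $n\in\mathbb Z_{\ge0}$, is $\varepsilon=(\varepsilon_0,\dots,\varepsilon_{2n})\in\{0,1\}^{2n+1}$ with $\varepsilon_0=0$, $\sum_{j=1}^{m}(2\varepsilon_j-1)\ge0$ for $1\le m<2n$, and $\sum_{j=1}^{2n}(2\varepsilon_j-1)=0$. $\mathcal E$ is the set of all excursions, $|\varepsilon|$ the length, and $\zeta_k(\varepsilon)$ the number of $k$-solitons obtained by applying the same algorithm to the word $\varepsilon_1\cdots\varepsilon_{2n}$. **Measures.** $\mathcal Q^+=\{\mathbf q\in[0,1)^{\mathbb N}:\sum_k kq_k<\infty\}$. For $\mathbf q\in\mathcal Q^+$, $\varphi_{\mathbf q}(\varepsilon)=\prod_{k\in\mathbb N}q_k^{\zeta_k(\varepsilon)}(1-q_k)^{1+2\sum_{\ell\in\mathbb N}\ell\zeta_{k+\ell}(\varepsilon)}$ is a probability measure on $\mathcal E$, and $\bar\varepsilon(\mathbf q)=\sum_\varepsilon|\varepsilon|\varphi_{\mathbf q}(\varepsilon)<\infty$. $\hat\phi_{\mathbf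 q}$ is the law of the concatenation $\cdots\varepsilon_{-1}\varepsilon_0\varepsilon_1\cdots$, first letter of $\varepsilon_0$ at site $0$, of i.i.d. excursions with law $\varphi_{\mathbf q}$. With $(\tau_y\eta)(x)=\eta(x+y)$, $\phi_{\mathbf q}$ is the probability measure on $\Omega_*$ with $\int f\,d\phi_{\mathbf q}=\frac1{\bar\varepsilon(\mathbf q)}\int d\hat\phi_{\mathbf q}(\eta)\sum_{y=0}^{s_\infty(\eta,1)-1}f(\tau_y\eta)$; it is invariant under $T$ and $\tau_y$. **Effective velocity.** For $\mathbf q\in\mathcal Q^+$ and $k\in\mathbb N$, $v^{\mathrm{eff}}_k(\mathbf q)$ denotes the effective velocity of $k$-solitons under $\phi_{\mathbf q}$, i.e. the average speed of $k$-solitons in the bi-infinite configuration evolving under $T$. It is known that, for each $k\in\mathbb N$, the numbers $v_\ell:=v^{\mathrm{eff}}_{k-\ell}(\theta^\ell\mathbf q)$, $0\le\ell\le k-1$, and $v_k:=0$ are determined by $$v_{\ell-1}+v_{\ell+1}-\frac{2v_\ell}{1-q_\ell}=0\quad(1\le\ell\le k-1),\qquad v_k=0,\quad v_{k-1}=\frac1{\bar\varepsilon(\theta^k\mathbf q)}.$$ *)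

(* Defs.v *)
From HB Require Import structures.
From mathcomp Require Import all_boot all_order all_algebra.
From mathcomp Require Import all_classical all_reals all_analysis.
From mathcomp Require Import measurable_realfun.
Import Order.TTheory GRing.Theory Num.Theory.
Import numFieldNormedType.Exports.

Set Implicit Arguments.
Unset Strict Implicit.
Unset Printing Implicit Defensive.

Local Open Scope classical_set_scope.
Local Open Scope ring_scope.

(** * Box-ball dynamics *)

Definition spin (b : bool) : int := 2 * (b : nat)%:Z - 1.

Definition Omega (R : realType) (eta : int -> bool) : Prop :=
  exists2 l : R, l < 1 / 2 &
    (fun x : nat => (\sum_(0 <= i < x.+1) (eta (- i%:Z) : nat)%:R) / x%:R : R)
      @ \oo --> l.

(* The sum over [z <= y <= x] is written with [z = x - n]. *)
Definition is_record (eta : int -> bool) (x : int) : Prop :=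
  forall n : nat, \sum_(0 <= i < n.+1) spin (eta (x - i%:Z)) < 0.

(* [s] is the increasing enumeration of the records when all its values are
   finite. *)
Definition record_enum (eta : int -> bool) (s : int -> int) : Prop :=
  [/\ forall i j : int, i < j -> s i < s j,
      range s = [set x | is_record eta x]
    & s 0 <= 0 < s 1].

Definition Omega_star (R : realType) (eta : int -> bool) : Prop :=
  Omega R eta /\ exists s, record_enum eta s.

(* Meaningful (and then unique) only when a two-sided enumeration exists, in
   particular on [Omega_star]; the default value 0 is irrelevant. *)
Definition s_inf (eta : int -> bool) : int -> int :=
  xget (fun=> 0) [set s | record_enum eta s].

(* [(W (x - 1)).-1] is the truncated predecessor [max (W (x - 1) - 1) 0]. *)
Definition is_carrier (eta : int -> bool) (W : int -> nat) : Prop :=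
  (forall x, is_record eta x -> W x = 0%N) /\
  (forall x, W x = if eta x then (W (x - 1)).+1 else (W (x - 1)).-1).

Definition carrier (eta : int -> bool) : int -> nat :=
  xget (fun=> 0%N) [set W | is_carrier eta W].

Definition evolve (eta : int -> bool) : int -> bool :=
  fun x => (eta x + carrier eta (x - 1) - carrier eta x == 1)%N.

Definition translate (y : int) (eta : int -> bool) : int -> bool :=
  fun x => eta (x + y).

(** * Takahashi-Satsuma algorithm *)

(* A word is a list of labelled letters (site, letter); the algorithm returns
   the list of solitons, each one the increasing list of its 2k sites with their
   letters. *)

Fixpoint runs (I : Type) (w : seq (I * bool)) : seq (seq (I * bool)) :=
  if w is p :: w' then
    if runs w' is (p' :: r) :: rs then
      if p.2 == p'.2 then (p :: p' :: r) :: rs else [:: p] :: (p' :: r) :: rs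
    else [:: [:: p]]
  else [::].

(* Select the leftmost run [r1] such that the following run [r2] is at least as
   long; return the soliton and the remaining word. *)
Fixpoint ts_step (I : Type) (rs : seq (seq (I * bool))) :
    option (seq (I * bool) * seq (I * bool)) :=
  if rs is r1 :: tl then
    if tl is r2 :: rs' then
      if (size r1 <= size r2)%N then
        Some (r1 ++ take (size r1) r2, drop (size r1) r2 ++ flatten rs')
      else if ts_step tl is Some (g, w) then Some (g, r1 ++ w) else None
    else None
  else None.

Fixpoint ts_loop (I : Type) (fuel : nat) (w : seq (I * bool)) :
    seq (seq (I * bool)) :=
  if fuel is n.+1 then
    if ts_step (runs w) is Some (g, w') then g :: ts_loop n w' else [::]
  else [::].

(* Each step deletes at least two letters, so [size w] steps are enough. *)
Definition takahashi_satsuma (I : Type) (w : seq (I * bool)) :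
    seq (seq (I * bool)) :=
  ts_loop (size w) w.

(** * Solitons of a configuration and their trajectories *)

Definition soliton : Type := seq (int * bool).

Definition word_between (eta : int -> bool) (a b : int) : seq (int * bool) :=
  [seq (a + 1 + i%:Z, eta (a + 1 + i%:Z)) | i <- iota 0 (`|b - a|%N).-1].

Definition is_soliton (eta : int -> bool) (k : nat) (g : soliton) : Prop :=
  size g = (2 * k)%N /\
  exists i : int,
    g \in takahashi_satsuma (word_between eta (s_inf eta i) (s_inf eta (i + 1))).

Definition soliton_head (g : soliton) : seq int := [seq p.1 | p <- g & p.2].
Definition soliton_tail (g : soliton) : seq int := [seq p.1 | p <- g & ~~ p.2].

Definition position (g : soliton) : int := (head (0, false) g).1.

(* Identity of a soliton through time: the sites occupied by the zeros of a
   k-soliton of [eta] are the sites occupied by the ones of exactly one k-soliton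
   of [evolve eta], and the latter is the same soliton one time step later. *)
Definition trajectory (eta : int -> bool) (k : nat) (g : nat -> soliton) :
    Prop :=
  forall t : nat,
    is_soliton (iter t evolve eta) k (g t) /\
    soliton_head (g t.+1) = soliton_tail (g t).

(** * Excursions *)

Definition excursion_height (e : seq bool) (m : nat) : int :=
  \sum_(1 <= j < m.+1) spin (nth false e j).

(* With [size e = 2 n + 1], [size e - 2 = 2 n - 1], so that [iota] enumerates
   the [m] with [1 <= m < 2 n]. *)
Definition is_excursion (e : seq bool) : bool :=
  [&& odd (size e), ~~ nth false e 0,
      all (fun m => 0 <= excursion_height e m) (iota 1 (size e - 2))
    & excursion_height e (size e).-1 == 0].

Definition excursion : Type := {e : seq bool | is_excursion e}.

Definition zeta (k : nat) (e : excursion) : nat :=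
  let w := behead (val e) in
  count (fun g => size g == (2 * k)%N)
        (takahashi_satsuma (zip (iota 1 (size w)) w)).

(** * Measures *)

(* Sequences indexed by {1, 2, ...} are functions on [nat] whose value at 0 is
   never used. *)

Definition theta (R : realType) (l : nat) (q : nat -> R) : nat -> R :=
  fun j => q (j + l)%N.

Definition Qplus (R : realType) (q : nat -> R) : Prop :=
  (forall k, (1 <= k)%N -> 0 <= q k < 1) /\
  (\sum_(1 <= k <oo) (k%:R * q k)%:E < +oo)%E.

(* The infinite product over [k] is the limit of its partial products; the sum
   over [l] is finite, since [zeta j e = 0] for [j > size e]. *)
Definition phi_weight (R : realType) (q : nat -> R) (e : excursion) : R :=
  limn (fun n : nat => \prod_(1 <= k < n.+1)
    (q k ^+ zeta k e *
     (1 - q k) ^+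
       (1 + 2 * \sum_(1 <= l < (size (val e)).+1) l * zeta (k + l) e)%N)).

Definition mean_length (R : realType) (q : nat -> R) : R :=
  fine (\esum_(e in [set: excursion])
          ((size (val e))%:R * phi_weight q e)%:E).

Definition cylinders : set (set (int -> bool)) :=
  [set A | exists (x : int) (b : bool), A = [set eta | eta x = b]].

(* {0,1}^Z with the product sigma-algebra. *)
Notation config := (g_sigma_algebraType cylinders).

(* [eta] is the concatenation of the [e i], where [S i] is the site of the first
   letter of [e i]. *)
Definition is_concatenation (e : int -> excursion) (eta : int -> bool) : Prop :=
  exists S : int -> int,
    S 0 = 0 /\
    forall i : int,
      S (i + 1) = S i + (size (val (e i)))%:Z /\
      forall j : nat, (j < size (val (e i)))%N ->
        eta (S i + j%:Z) = nth false (val (e i)) j.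

(* Since there are countably many excursions, the product rule on singletons
   says both that each [X i] has law [phi_weight q] and that the [X i] are
   mutually independent. *)
Definition iid_excursions (R : realType) (q : nat -> R) (d : measure_display)
    (T : measurableType d) (P : probability T R) (X : int -> T -> excursion) :
    Prop :=
  (forall i e, measurable (X i @^-1` [set e])) /\
  forall (F : seq int) (e : int -> excursion), uniq F ->
    P (\bigcap_(i in [set` F]) X i @^-1` [set e i]) =
    (\prod_(i <- F) phi_weight q (e i))%:E.

Definition is_phi_hat (R : realType) (q : nat -> R)
    (phat : probability config R) : Prop :=
  exists (d : measure_display) (T : measurableType d) (P : probability T R)
         (X : int -> T -> excursion) (H : T -> config),
    [/\ iid_excursions q P X,
        forall w, is_concatenation (fun i => X i w) (H w),
        measurable_fun setT H
      & forall A, measurable A -> phat A = P (H @^-1` A)].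

Definition is_phi (R : realType) (q : nat -> R)
    (phi : probability config R) : Prop :=
  exists phat : probability config R, is_phi_hat q phat /\
    forall f : config -> \bar R,
      measurable_fun setT f -> (forall eta, 0 <= f eta)%E ->
      (\int[phi]_eta f eta =
       ((mean_length q)^-1)%:E *
       \int[phat]_eta
         \sum_(0 <= y < `|s_inf eta 1|) f (translate y%:Z eta))%E.

(** * Effective velocity *)

Definition is_average_speed (R : realType) (phi : probability config R)
    (k : nat) (v : R) : Prop :=
  {ae phi, forall eta, Omega_star R eta ->
     forall g : nat -> soliton, trajectory eta k g ->
       (fun t : nat => (position (g t))%:~R / t%:R : R) @ \oo --> v}.

(* For every parameter, the k-solitons almost surely travel at speed
   [veff k q]. When [q k = 0] there are no k-solitons and this says nothing. *)
Definition average_speed_property (R : realType)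
    (veff : nat -> (nat -> R) -> R) : Prop :=
  forall (q : nat -> R) (k : nat) (phi : probability config R),
    Qplus q -> (1 <= k)%N -> is_phi q phi -> is_average_speed phi k (veff k q).

(* [v_l = veff (k - l) (theta l q)], with the convention [v_k = 0]. *)
Definition shifted_velocity (R : realType) (veff : nat -> (nat -> R) -> R)
    (q : nat -> R) (k l : nat) : R :=
  if (l < k)%N then veff (k - l)%N (theta l q) else 0.

(* The known linear system for the effective velocities; it also gives their
   values when some [q k] vanish. *)
Definition velocity_system (R : realType)
    (veff : nat -> (nat -> R) -> R) : Prop :=
  forall (q : nat -> R) (k : nat), Qplus q -> (1 <= k)%N ->
    let v := shifted_velocity veff q k in
    (forall l, (1 <= l <= k.-1)%N ->
       v l.-1 + v l.+1 - 2 * v l / (1 - q l) = 0) /\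
    v k.-1 = 1 / mean_length (theta k q).

(* Main.v *)
(* For this family the law of an excursion is that of a nearest-neighbour walk
   whose steps form a Markov chain on {0,1}, stopped at its first visit to -1.
   With D_k = 1 - c^k d one has 1 - q_k = D_(k-1) D_(k+1) / D_k^2, so that
   q_k prod_(j<k) (1 - q_j)^(2 (k - j)) telescopes to A x^(k-1), which is exactly
   the factor by which the Markov weight of a word drops when the
   Takahashi-Satsuma algorithm erases a k-soliton. The mean length of an
   excursion is then the mean hitting time (1 + d) / (1 - d), the inverse of the
   drift of the walk. As theta^k q is the same family with d replaced by c^k d,
   the linear system for the velocities is explicit, and the closed formula
   follows from it by downward induction on l. *)
Require Import Defs.
From HB Require Import structures.
From mathcomp Require Import all_boot all_order all_algebra.
From mathcomp Require Import all_classical all_reals all_analysis.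
From mathcomp Require Import zify ring lra.
Import Order.TTheory GRing.Theory Num.Theory.
Import numFieldNormedType.Exports.
Local Open Scope ring_scope.

(** * Ballot words *)

(** A height counter that aborts with [None] below 0. As an automaton it composes over
    concatenation, which makes the erasure of a factor easy to follow. *)
Fixpoint ballot (h : nat) (w : seq bool) : option nat :=
  match w with
  | [::] => Some h
  | true :: w' => ballot h.+1 w'
  | false :: w' => if h is h'.+1 then ballot h' w' else None
  end.

Lemma ballot_cat h u v : ballot h (u ++ v) = obind (ballot^~ v) (ballot h u).
Proof. by elim: u h => [|[] u IHu] [|h] /=. Qed.

Lemma ballot_count h w h' :
  ballot h w = Some h' -> (h + count id w = h' + count negb w)%N.
Proof.
elim: w h => [|[] w IHw] h /=; first by case=> ->.
- by move=> /IHw /=; lia.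
- by case: h => // h /IHw /=; lia.
Qed.

Lemma ballot_nseq_true h k : ballot h (nseq k true) = Some (h + k)%N.
Proof. by elim: k h => [|k IHk] h /=; rewrite ?addn0 // IHk addSnnS. Qed.

Lemma ballot_nseq_false h k :
  ballot h (nseq k false) = if (k <= h)%N then Some (h - k)%N else None.
Proof. by elim: k h => [|k IHk] [|h] //=; rewrite ?subn0 // IHk ltnS subSS. Qed.

(** For [b = true] the block rises by [k] and returns; for [b = false] it dips by [k], and success
    on the left forces [k <= h]. Hence an implication only. *)
Lemma ballot_soliton h k b v h' :
  ballot h (nseq k b ++ nseq k (~~ b) ++ v) = Some h' -> ballot h v = Some h'.
Proof.
case: b; rewrite /= ballot_cat ?ballot_nseq_true ?ballot_nseq_false /=.
  by rewrite ballot_cat ballot_nseq_false leq_addl /= addnK.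
by case: leqP => //= kh; rewrite ballot_cat ballot_nseq_true /= subnK.
Qed.

Lemma excursion_heightE b w m :
  excursion_height (b :: w) m = \sum_(0 <= j < m) spin (nth false w j).
Proof. by rewrite /excursion_height big_add1. Qed.

Lemma ballot_heights (h : nat) w :
  (ballot h w == Some 0%N) =
  [forall m : 'I_(size w).+1,
     0 <= h%:Z + \sum_(0 <= j < m) spin (nth false w j)] &&
  (h%:Z + \sum_(0 <= j < size w) spin (nth false w j) == 0).
Proof.
elim: w h => [|b w IHw] h /=.
  rewrite big_nil addr0; apply/eqP/andP; last by case=> _ /eqP[->].
  by case=> ->; split=> //; apply/forallP => -[[|//] i]; rewrite big_nil.
rewrite big_nat_recl //=.
have step (h' : nat) : h%:Z + spin b = h' :> int ->
    (ballot h' w == Some 0%N) =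
    [forall m : 'I_(size w).+2,
       0 <= h%:Z + \sum_(0 <= j < m) spin (nth false (b :: w) j)] &&
    (h%:Z + (spin b + \sum_(0 <= i < size w) spin (nth false w i)) == 0).
  move=> hh'; rewrite IHw addrA hh'; congr (_ && _).
  apply/forallP/forallP => [H [[|m] mlt] | H [m mlt]].
  - by rewrite big_nil addr0.
  - by rewrite big_nat_recl //= addrA hh'; exact: (H (Ordinal (mlt : (m < (size w).+1)%N))).
  - have := H (Ordinal (mlt : (m.+1 < (size w).+2)%N)).
    by rewrite big_nat_recl //= addrA hh'.
case: b step => step; first by apply: step; rewrite /spin; lia.
case: h step => [|h] step; last by apply: step; rewrite /spin; lia.
apply/esym/negbTE; rewrite negb_and; apply/orP; left.
apply/forallPn; exists (Ordinal (isT : (1 < (size w).+2)%N)).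
by rewrite big_nat1 /=.
Qed.

Lemma is_excursionE b w :
  is_excursion (b :: w) = ~~ b && (ballot 0 w == Some 0%N).
Proof.
rewrite /is_excursion [nth _ _ 0]/= [(size _).-1]/= excursion_heightE.
case: b => /=; rewrite ?andbF // ballot_heights add0r.
apply/and3P/andP => [[w_even /allP pos w0]|[/forallP pos w0]]; split=> //.
- apply/forallP => -[m mlt]; rewrite add0r [nat_of_ord _]/= -(excursion_heightE false).
  case: m mlt => [|m] mlt; first by rewrite excursion_heightE big_nil.
  case: (ltnP m.+1 (size w)) => msw.
    by apply: pos; rewrite mem_iota /=; move: mlt msw; rewrite subSS; lia.
  by rewrite excursion_heightE (_ : m.+1 = size w) ?(eqP w0) //; lia.
(* The length of [w] is even because a path from 0 to 0 has as many ones as zeros. *)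
- have : ballot 0 w == Some 0%N.
    by rewrite ballot_heights add0r w0 andbT; apply/forallP.
  move=> /eqP /ballot_count /=; rewrite !add0n => eqc.
  by rewrite -(count_predC id w) [count (predC _) _]/= -eqc addnn odd_double.
- apply/allP => m; rewrite mem_iota subSS => /andP[m1 m2].
  have mlt : (m < (size w).+1)%N by lia.
  by have := pos (Ordinal mlt); rewrite add0r excursion_heightE.
Qed.

(** * The Takahashi-Satsuma algorithm *)

Fixpoint alternating {I : Type} (b : bool) (rs : seq (seq (I * bool))) : bool :=
  if rs is r :: tl then
    [&& (0 < size r)%N, unzip2 r == nseq (size r) b & alternating (~~ b) tl]
  else true.

Lemma runs_cons {I : Type} (p : I * bool) (w : seq (I * bool)) :
  exists r rs, runs (p :: w) = (p :: r) :: rs.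
Proof.
rewrite /=; case: (runs w) => [|[|p' r] rs]; do ?by exists [::], [::].
by case: ifP => _; [exists (p' :: r), rs | exists [::], ((p' :: r) :: rs)].
Qed.

Lemma flatten_runs {I : Type} (w : seq (I * bool)) : flatten (runs w) = w.
Proof.
elim: w => // p [//|p' w] IHw.
have [r [rs runsE]] := runs_cons p' w.
rewrite -[runs (p :: _)]/(if runs (p' :: w) is (p' :: r) :: rs then
  if p.2 == p'.2 then (p :: p' :: r) :: rs else [:: p] :: (p' :: r) :: rs
  else [:: [:: p]]).
by rewrite -[in RHS]IHw runsE; case: ifP.
Qed.

Lemma alternating_runs {I : Type} (p : I * bool) (w : seq (I * bool)) :
  alternating p.2 (runs (p :: w)).
Proof.
elim: w p => [|p' w IHw] p; first by rewrite /= eqxx.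
have {IHw} := IHw p'; have [r [rs runsE]] := runs_cons p' w.
rewrite -[runs (p :: _)]/(if runs (p' :: w) is (p' :: r) :: rs then
  if p.2 == p'.2 then (p :: p' :: r) :: rs else [:: p] :: (p' :: r) :: rs
  else [:: [:: p]]) runsE.
case: (eqVneq p.2 p'.2) => /= [->|npp]; first by rewrite !eqseq_cons !eqxx.
by have -> : ~~ p.2 = p'.2; [case: p.2 p'.2 npp => -[] | rewrite eqxx].
Qed.

Lemma ts_step_cons {I : Type} r1 r2 (rs : seq (seq (I * bool))) :
  ts_step (r1 :: r2 :: rs) =
  if (size r1 <= size r2)%N then
    Some (r1 ++ take (size r1) r2, drop (size r1) r2 ++ flatten rs)
  else if ts_step (r2 :: rs) is Some (g, w) then Some (g, r1 ++ w) else None.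
Proof. by []. Qed.

Lemma ts_step_soliton {I : Type} b (rs : seq (seq (I * bool))) g w' :
  alternating b rs -> ts_step rs = Some (g, w') ->
  exists u v b' k,
    [/\ flatten rs = u ++ g ++ v, w' = u ++ v,
        unzip2 g = nseq k.+1 b' ++ nseq k.+1 (~~ b')
      & last (~~ b) (unzip2 u) = ~~ b'].
Proof.
elim: rs b g w' => [//|r1 rs IHrs] b g w' alt.
case: rs IHrs alt => [//|r2 rs] IHrs alt; rewrite ts_step_cons.
have /and3P[r1_gt0 /eqP r1E alt2] := alt.
case: ifP => [r12 [<- <-]|_].
  exists [::], (drop (size r1) r2 ++ flatten rs), b, (size r1).-1.
  split=> //=.
    by rewrite -catA [X in _ = _ ++ X]catA cat_take_drop.
  case/and3P: alt2 => _ /eqP r2E _.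
  rewrite -[RHS]/(nseq (size r1).-1.+1 b ++ nseq (size r1).-1.+1 (~~ b)).
  rewrite prednK // /unzip2 map_cat -/(unzip2 r1) r1E map_take -/(unzip2 r2) r2E.
  by rewrite take_nseq.
case E: (ts_step _) => [[g' w'']|//] [<- <-].
have [u [v [b' [k [uE vE gE uL]]]]] := IHrs _ _ _ alt2 E.
exists (r1 ++ u), v, b', k; split=> //=.
- by rewrite -catA -uE.
- by rewrite vE catA.
- rewrite /unzip2 map_cat last_cat -/(unzip2 r1) r1E -/(unzip2 u) -uL negbK.
  by congr last; case: (size r1) r1_gt0 => // n _; elim: n.
Qed.

(** When no run is followed by one at least as long, the run lengths strictly decrease, so their
    alternating sum lies between 1 and the first length. The upper bound carries the induction. *)
Lemma ts_step_None {I : Type} b (r : seq (I * bool)) rs :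
  alternating b (r :: rs) -> ts_step (r :: rs) = None ->
  (count_mem (~~ b) (unzip2 (flatten (r :: rs))) <
   count_mem b (unzip2 (flatten (r :: rs))) <=
   count_mem (~~ b) (unzip2 (flatten (r :: rs))) + size r)%N.
Proof.
elim: rs b r => [|r2 rs IHrs] b r1; last rewrite ts_step_cons; rewrite [alternating _ _]/=.
  case/and3P => r_gt0 /eqP rE _ _.
  by rewrite /= cats0 rE !count_nseq /= eqxx; case: b {rE} => /=; lia.
case/and3P => r_gt0 /eqP rE alt2; case: ifP => // /negbT; rewrite -ltnNge => r21.
case E: (ts_step _) => [[? ?]|] // _.
have := IHrs _ _ alt2 E; rewrite negbK => IH.
rewrite [flatten (r1 :: _)]/= -[_ ++ flatten rs]/(flatten (r2 :: rs)).
rewrite /unzip2 map_cat -/(unzip2 r1) rE !count_cat !count_nseq /= eqxx.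
by move: IH; rewrite /unzip2; case: b {rE alt2} => /=; lia.
Qed.

(** A stuck word has a strict majority of its first letter, so a balanced one is never stuck. The
    default [false] in [last] is the initial 0 of the excursion. *)
Lemma ts_step_runs {I : Type} (w : seq (I * bool)) :
  ballot 0 (unzip2 w) = Some 0%N -> w <> [::] ->
  exists u g v b k,
    [/\ w = u ++ g ++ v, ts_step (runs w) = Some (g, u ++ v),
        unzip2 g = nseq k.+1 b ++ nseq k.+1 (~~ b)
      & last false (unzip2 u) = ~~ b].
Proof.
case: w => [//|p w] wdyck _.
have p1 : p.2 = true by move: wdyck => /=; case: p.2.
have := alternating_runs p w; rewrite p1 => alt.
case E: (ts_step _) => [[g w']|].
  have [u [v [b [k [uE vE gE uL]]]]] := ts_step_soliton _ _ _ _ alt E.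
  exists u, g, v, b, k; split=> //; first by rewrite -uE flatten_runs.
  by rewrite -vE.
case rE: (runs (p :: w)) alt E => [|r rs] alt E.
  by have := flatten_runs (p :: w); rewrite rE.
have rrsE : flatten (r :: rs) = p :: w by rewrite -rE flatten_runs.
have := ts_step_None _ _ _ alt E; rewrite rrsE.
have := ballot_count _ _ _ wdyck; rewrite !add0n => eqc.
have -> : count_mem true (unzip2 (p :: w)) = count id (unzip2 (p :: w)).
  by apply: eq_count => -[].
have -> : count_mem false (unzip2 (p :: w)) = count negb (unzip2 (p :: w)).
  by apply: eq_count => -[].
by rewrite eqc ltnn.
Qed.

Lemma size_soliton {I : Type} (g : seq (I * bool)) b k :
  unzip2 g = nseq k.+1 b ++ nseq k.+1 (~~ b) -> size g = k.+1.*2.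
Proof. by move/(congr1 size); rewrite size_map size_cat !size_nseq addnn. Qed.

Lemma ballot_erase_soliton {I : Type} (u g v : seq (I * bool)) b k h' :
  unzip2 g = nseq k b ++ nseq k (~~ b) ->
  ballot 0 (unzip2 (u ++ g ++ v)) = Some h' ->
  ballot 0 (unzip2 (u ++ v)) = Some h'.
Proof.
move=> gE; rewrite /unzip2 !map_cat ballot_cat [in X in _ -> X]ballot_cat.
case: (ballot 0 _) => //= h; rewrite -/(unzip2 g) gE -catA.
exact: ballot_soliton.
Qed.

Lemma size_ts_loop {I : Type} n (w : seq (I * bool)) :
  ballot 0 (unzip2 w) = Some 0%N ->
  all (fun g => (size g == (size g)./2.*2) && (0 < (size g)./2 <= size w)%N)
    (ts_loop n w).
Proof.
elim: n w => [//|n IHn] w wdyck /=.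
case E: w => [//|p w']; rewrite -E.
have /(ts_step_runs _ wdyck) : w <> [::] by rewrite E.
case=> u [g [v [b [k [wE -> gE _]]]]] /=.
have sg := size_soliton _ _ _ gE.
rewrite sg doubleK eqxx /= wE !size_cat sg -addnn; apply/andP; split; first lia.
apply: sub_all (IHn (u ++ v) _) => [g'|].
  by rewrite size_cat => /andP[-> /andP[-> /=]]; lia.
by apply: (ballot_erase_soliton _ g _ _ _ _ gE); rewrite -wE.
Qed.

(** * Markov weights of words *)

Definition letter_weight {R : pzRingType} (p : bool -> R) (b b' : bool) : R :=
  if b' then p b else 1 - p b.

(* The final factor is the probability of the down-step that ends the
   excursion; an excursion is read from its second letter on, and its first
   letter serves as this last step. *)
Fixpoint word_weight {R : pzRingType} (p : bool -> R) (b : bool) (w : seq bool) : R :=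
  if w is b' :: w' then letter_weight p b b' * word_weight p b' w'
  else letter_weight p b false.

(** The transitions used by a [k]-soliton of either orientation read after a copy of its last
    letter: one change each way, [k - 1] repetitions of each letter. *)
Definition soliton_weight {R : pzRingType} (p : bool -> R) (k : nat) : R :=
  letter_weight p false true * letter_weight p true false *
  (letter_weight p true true * letter_weight p false false) ^+ k.-1.

Lemma word_weight_nseq {R : pzRingType} (p : bool -> R) b k v :
  word_weight p b (nseq k b ++ v) = letter_weight p b b ^+ k * word_weight p b v.
Proof. by elim: k => [|k /= ->]; rewrite ?mul1r // exprS mulrA. Qed.

Lemma word_weight_soliton {R : comPzRingType} (p : bool -> R) b k v :
  word_weight p (~~ b) (nseq k.+1 b ++ nseq k.+1 (~~ b) ++ v) =
  soliton_weight p k.+1 * word_weight p (~~ b) v.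
Proof.
rewrite /= word_weight_nseq /= word_weight_nseq /soliton_weight exprMn.
by case: b => /=; ring.
Qed.

Lemma word_weight_cat {R : comPzRingType} (p : bool -> R) a b u z z' :
  word_weight p (last b u) z = a * word_weight p (last b u) z' ->
  word_weight p b (u ++ z) = a * word_weight p b (u ++ z').
Proof. by elim: u b => //= c u IHu b /IHu ->; rewrite mulrCA. Qed.

(* Erasing a soliton divides the weight of a word by a factor depending only on
   the size of the soliton: the letter before it differs from its first letter
   and agrees with its last one. *)
Lemma word_weight_ts_loop {R : comPzRingType} {I : Type} (p : bool -> R) n
    (w : seq (I * bool)) :
  ballot 0 (unzip2 w) = Some 0%N -> (size w <= n)%N ->
  word_weight p false (unzip2 w) =
  letter_weight p false false *
  \prod_(k <- [seq (size g)./2 | g <- ts_loop n w]) soliton_weight p k.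
Proof.
elim: n w => [|n IHn] w wdyck swn.
  by case: w wdyck swn => // _ _; rewrite big_nil mulr1.
case E: w => [|c w']; first by rewrite big_nil mulr1.
rewrite -E; have /(ts_step_runs _ wdyck) : w <> [::] by rewrite E.
case=> u [g [v [b [k [wE tsE gE uL]]]]].
have sg := size_soliton _ _ _ gE.
rewrite [ts_loop _ _]/= tsE map_cons big_cons sg doubleK.
have uvdyck : ballot 0 (unzip2 (u ++ v)) = Some 0%N.
  by apply: (ballot_erase_soliton _ g _ _ _ _ gE); rewrite -wE.
rewrite mulrCA -IHn //; last first.
  by move: swn; rewrite wE !size_cat sg -addnn; lia.
rewrite wE /unzip2 !map_cat; apply: word_weight_cat.
by rewrite -/(unzip2 u) -/(unzip2 g) uL gE -catA word_weight_soliton.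
Qed.

(** * The soliton weight of an excursion *)

Lemma sum_delta_shift (N j k : nat) : (0 < j <= N)%N ->
  (\sum_(1 <= l < N.+1) l * (j == k + l) = j - k)%N.
Proof.
move=> /andP[j0 jN].
have delta m M : (\sum_(1 <= l < M.+1) l * (l == m) = if m <= M then m else 0)%N.
  elim: M => [|M IHM]; first by rewrite big_nil; case: m.
  rewrite big_nat_recr //= IHM.
  by case: (ltngtP m M.+1); case: (ltngtP m M); lia.
rewrite (eq_big_nat _ _ (F2 := fun l => l * (l == j - k))%N); last first.
  by move=> l /andP[l0 _]; congr (_ * nat_of_bool _)%N; lia.
by rewrite delta ifT //; lia.
Qed.

Lemma prod_expr_delta {R : pzSemiRingType} (q : nat -> R) (n j : nat) :
  (0 < j <= n)%N -> \prod_(1 <= k < n.+1) q k ^+ (j == k) = q j.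
Proof.
move=> jn; have -> : q j = if (0 < j <= n)%N then q j else 1 by rewrite jn.
elim: n {jn} => [|n IHn]; first by rewrite big_nil; case: j.
rewrite big_nat_recr //= IHn; case: (eqVneq j n.+1) => [->|jn] /=.
  by rewrite ltnn leqnn mul1r expr1.
by rewrite expr0 mulr1; congr (if _ then _ else _); lia.
Qed.

(** Regrouping by solitons: a [j]-soliton contributes [q j] and [2 * (j - k)] factors [1 - q k] for
    each [k < j]; the 1 in the exponent gives the product common to all excursions. *)
Lemma prod_soliton_counts {R : comPzRingType} (q : nat -> R) (ks : seq nat) (N n : nat) :
  all (fun j => 0 < j <= N)%N ks -> (N <= n)%N ->
  \prod_(1 <= k < n.+1) (q k ^+ count_mem k ks *
     (1 - q k) ^+ (1 + 2 * \sum_(1 <= l < N.+1) l * count_mem (k + l) ks)%N) =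
  \prod_(1 <= k < n.+1) (1 - q k) *
  \prod_(j <- ks) (q j * \prod_(1 <= k < n.+1) (1 - q k) ^+ (2 * (j - k))%N).
Proof.
move=> + Nn; elim: ks => [_|j ks IHks /andP[jN ksN]].
  rewrite big_nil mulr1; apply: eq_bigr => k _.
  by rewrite big1 ?expr1 ?mul1r // => l _; rewrite muln0.
rewrite big_cons mulrCA -IHks //.
rewrite -{1}(prod_expr_delta q n j); last by lia.
rewrite -!big_split /=; apply: eq_bigr => k _.
rewrite -(sum_delta_shift N j k) //.
rewrite (eq_bigr (fun l => l * (j == k + l) + l * count_mem (k + l) ks)%N); last first.
  by move=> l _; rewrite mulnDr.
by rewrite big_split /= mulnDr addnCA !exprD; ring.
Qed.

(** The probability of a 1 after the letter [b]. For [d > 0] it is forced by the excursion 0, of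
    weight prod_k (1 - q_k) = (1 - d) / (1 - c d), and the excursion 010, of weight q_1 times
    that. *)
Definition next_one {R : fieldType} (c d : R) (b : bool) : R :=
  (if b then c * (1 - d) else d * (1 - c)) / (1 - c * d).

Lemma one_sub_exprM_gt0 {R : realFieldType} (c d : R) k :
  0 <= c < 1 -> 0 <= d < 1 -> 0 < 1 - c ^+ k * d.
Proof.
move=> /andP[c0 c1] /andP[d0 d1]; rewrite subr_gt0.
by apply: le_lt_trans d1; rewrite ler_piMl // exprn_ile1 // ltW.
Qed.

Section SolitonWeight.
Local Open Scope classical_set_scope.
Local Open Scope ring_scope.
Variables (R : realType) (q : nat -> R) (c d : R).
Hypotheses (c01 : 0 <= c < 1) (d01 : 0 <= d < 1).
Hypothesis qE : forall k, (1 <= k)%N ->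
  q k = c ^+ k.-1 * d * (1 - c) ^+ 2 / (1 - c ^+ k * d) ^+ 2.

Let D k : R := 1 - c ^+ k * d.

Let D_neq0 k : D k != 0.
Proof. by rewrite gt_eqF // one_sub_exprM_gt0. Qed.

(* The second difference of [ln D] is [ln (1 - q)]; all the products below
   telescope. *)
Lemma one_sub_q k : 1 - q k.+1 = D k * D k.+2 / D k.+1 ^+ 2.
Proof.
rewrite qE //= -/(D k.+1).
apply: (mulIf (expf_neq0 2 (D_neq0 k.+1))); rewrite mulrBl !divfK ?expf_neq0 //.
by rewrite /D !exprS; ring.
Qed.

Lemma prod_one_sub_q n :
  \prod_(1 <= k < n.+1) (1 - q k) = D 0 * D n.+1 / (D 1 * D n).
Proof.
elim: n => [|n IHn]; first by rewrite big_nil [_ * D 1]mulrC divff ?mulf_neq0.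
rewrite big_nat_recr //= IHn one_sub_q.
by field; rewrite !D_neq0.
Qed.

Lemma prod_one_sub_q_expr j :
  \prod_(1 <= k < j.+1) (1 - q k) ^+ (j.+1 - k) =
  D j.+1 / D 0 * (D 0 / D 1) ^+ j.+1.
Proof.
elim: j => [|j IHj]; first by rewrite big_nil expr1; field; rewrite !D_neq0.
(* Passing from [j] to [j + 1] raises every exponent by one, which multiplies by one more full
   product. *)
rewrite (eq_big_nat _ _ (F2 := fun k => (1 - q k) * (1 - q k) ^+ (j.+1 - k))).
  rewrite big_split /= prod_one_sub_q big_nat_recr //= subnn expr0 mulr1 IHj.
  by rewrite [(D 0 / D 1) ^+ j.+2]exprS; field; rewrite !D_neq0.
by move=> k kj; rewrite -exprS; congr (_ ^+ _); lia.
Qed.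

(** The telescoped product contains [D j ^+ 2], which cancels the denominator of [q j] and leaves a
    geometric sequence in [j]. *)
Lemma soliton_weightE j n : (0 < j <= n)%N ->
  q j * \prod_(1 <= k < n.+1) (1 - q k) ^+ (2 * (j - k))%N =
  soliton_weight (next_one c d) j.
Proof.
case: j => // j /andP[_ jn].
rewrite (@big_cat_nat _ _ _ j.+1) //=; last by rewrite ltnW.
rewrite [X in _ * (_ * X)]big_nat [X in _ * (_ * X)]big1 ?mulr1; last first.
  by move=> k /andP[jk _]; rewrite (_ : j.+1 - k = 0)%N ?muln0 ?expr0 //; lia.
under eq_bigr do rewrite mulnC exprM.
rewrite prodrXl prod_one_sub_q_expr qE // -/(D j.+1).
have D0 : D 0 = 1 - d by rewrite /D mul1r.
have D1 : D 1 = 1 - c * d by [].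
have d1 : 1 - d != 0 by rewrite -D0.
have cd1 : 1 - c * d != 0 by rewrite -D1.
rewrite /soliton_weight /= /next_one D0 D1.
have -> : c * (1 - d) / (1 - c * d) * (1 - d * (1 - c) / (1 - c * d)) =
          c * ((1 - d) / (1 - c * d)) ^+ 2 by field.
rewrite [X in _ = _ * X]exprMn exprAC [(_ / _) ^+ j.+1]exprS.
by field; rewrite cd1 d1 D_neq0.
Qed.

Lemma cvg_prod_one_sub_q :
  (fun n => \prod_(1 <= k < n.+1) (1 - q k)) @ \oo -->
  letter_weight (next_one c d) false false.
Proof.
have cvgD : D n @[n --> \oo] --> (1 : R).
  rewrite -[X in _ --> X]subr0 -(mul0r d).
  apply: cvgB; first exact: cvg_cst.
  by apply: cvgMl; apply: cvg_expr; case/andP: c01 => c0 c1; rewrite ger0_norm.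
under eq_fun do rewrite prod_one_sub_q.
have -> : letter_weight (next_one c d) false false = D 0 * 1 / (D 1 * 1).
  have cd1 : 1 - c * d != 0 by rewrite -[c]expr1 -/(D 1).
  by rewrite /letter_weight /next_one /D expr1; field.
apply: cvgM; first by apply: cvgM; [exact: cvg_cst | rewrite cvg_shiftS].
apply: cvgV; first by rewrite mulr1.
by apply: cvgM; [exact: cvg_cst |].
Qed.

(** For large [n] only the product of the [1 - q k] still varies; its limit is the probability of a
    0 after a 0, the factor left once all solitons are erased. *)
Lemma phi_weightE (e : excursion) :
  phi_weight q e = word_weight (next_one c d) false (behead (val e)).
Proof.
case: e => -[//|b w] /=; rewrite /phi_weight /zeta /= => wexc.
have /andP[_ /eqP wdyck] : ~~ b && (ballot 0 w == Some 0%N).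
  by rewrite -is_excursionE.
set z := zip _ w.
have zw : unzip2 z = w by rewrite unzip2_zip // size_iota.
have szw : size z = size w by rewrite -[in RHS]zw size_map.
have zdyck : ballot 0 (unzip2 z) = Some 0%N by rewrite zw.
have /allP zsizes := size_ts_loop (size z) z zdyck.
set ks := [seq (size g)./2 | g <- takahashi_satsuma z].
have ksE k : count (fun g => size g == (2 * k)%N) (takahashi_satsuma z) =
             count_mem k ks.
  rewrite count_map; apply: eq_in_count => g /zsizes /andP[/eqP gE _] /=.
  by rewrite {1}gE mul2n (inj_eq double_inj).
have ksN : all (fun j => 0 < j <= (size w).+1)%N ks.
  rewrite all_map; apply/allP => g /zsizes /=; rewrite szw; lia.
rewrite -[in RHS]zw (word_weight_ts_loop _ (size z)) // -/ks.
apply/cvg_lim => //.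
have : (\prod_(1 <= k < n.+1) (1 - q k) *
        \prod_(k <- ks) soliton_weight (next_one c d) k) @[n --> \oo] -->
   letter_weight (next_one c d) false false *
     \prod_(k <- ks) soliton_weight (next_one c d) k.
  by apply: cvgMl; exact: cvg_prod_one_sub_q.
apply: cvg_trans; apply: near_eq_cvg; near=> n.
have Nn : ((size w).+1 <= n)%N by near: n; exact: nbhs_infty_ge.
under [RHS]eq_bigr => k _.
  rewrite ksE; under eq_bigr => l _ do rewrite ksE; over.
rewrite (prod_soliton_counts q ks _ n ksN) //; congr (_ * _).
apply: eq_big_seq => j /(allP ksN) /andP[j0 jN].
by rewrite (soliton_weightE _ n) // j0 (leq_trans jN).
Unshelve. all: by end_near.
Qed.

End SolitonWeight.

(** * The mean first-passage time *)

(* The nearest-neighbour walk on the integers whose steps form a Markov chain on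
   [bool], killed at -1. *)
Definition killed_step {R : pzRingType} (p : bool -> R)
    (f : nat -> bool -> R) (h : nat) (b : bool) : R :=
  letter_weight p b true * f h.+1 true +
  letter_weight p b false * (if h is h'.+1 then f h' false else 0).

Definition exit_prob {R : pzRingType} (p : bool -> R) (h : nat) (b : bool) : R :=
  if h is 0 then letter_weight p b false else 0.

Section FirstPassage.
Local Open Scope classical_set_scope.
Local Open Scope ring_scope.
Variables (R : realType) (p : bool -> R) (g mu : R).

(* [g] corrects the height of the walk so that its drift is [- mu] in both
   states. *)
Hypothesis p01 : forall b, 0 <= p b <= 1.
Hypotheses (g_gt0 : 0 < g) (mu_gt0 : 0 < mu).
Hypothesis drift_false : p false * g - (1 - p false) = - mu.
Hypothesis drift_true : p true - (1 - p true) * g = - mu.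

Let K n := iter n (killed_step p).

Let letter_weight_ge0 b b' : 0 <= letter_weight p b b'.
Proof. by have /andP[p0 p1] := p01 b; case: b' => //=; rewrite subr_ge0. Qed.

Lemma word_weight_ge0 b w : 0 <= word_weight p b w.
Proof.
elim: w b => [|b' w IHw] b; first exact: letter_weight_ge0.
exact: mulr_ge0.
Qed.

Lemma iter_killed_step_le n f f' :
  (forall h b, f h b <= f' h b) -> forall h b, K n f h b <= K n f' h b.
Proof.
move=> ff'; elim: n => //= n IHn h b.
by apply: lerD; apply: ler_wpM2l => //; case: h.
Qed.

Lemma iter_killed_step_ge0 n f :
  (forall h b, 0 <= f h b) -> forall h b, 0 <= K n f h b.
Proof.
move=> f0; elim: n => //= n IHn h b.
by apply: addr_ge0; apply: mulr_ge0 => //; case: h.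
Qed.

Lemma iter_killed_stepD n f f' h b :
  K n (fun h b => f h b + f' h b) h b = K n f h b + K n f' h b.
Proof.
elim: n h b => //= n IHn h b; rewrite /killed_step IHn.
by case: h => [|h]; rewrite ?IHn; ring.
Qed.

Let one (h : nat) (b : bool) : R := 1.

(** The offset 1 in state [false] makes the height vanish at the killed position -1, so no boundary
    term appears at [h = 0]. *)
Let height (h : nat) (b : bool) : R := h%:R + if b then g else 1.

Let height_gt0 h b : 0 < height h b.
Proof. by case: b; rewrite ltr_wpDl. Qed.

Lemma killed_step_quadratic x y h b :
  killed_step p (fun h b => x * height h b ^+ 2 + y * height h b) h b =
  x * (height h b ^+ 2 - 2 * mu * height h b +
       if b then p true + (1 - p true) * g ^+ 2
       else p false * g ^+ 2 + (1 - p false)) + y * (height h b - mu).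
Proof.
rewrite -[mu]opprK; case: b; [rewrite -drift_true | rewrite -drift_false];
  by case: h => [|h]; rewrite /killed_step /letter_weight /height ?mulrS; ring.
Qed.

Let time (h : nat) (b : bool) : R := mu^-1 * height h b.

(** The quadratic term yields the decrease [time]; the linear one loses
    [(g ^+ 2 + 1) / (2 * mu ^+ 2)] per step, which absorbs the second moment of the increment, at
    most [g ^+ 2 + 1]. *)
Let lyapunov (h : nat) (b : bool) : R :=
  (2 * mu ^+ 2)^-1 * height h b ^+ 2 +
  (2 * mu ^+ 3)^-1 * (g ^+ 2 + 1) * height h b.

Let one_step : one = (fun h b => killed_step p one h b + exit_prob p h b).
Proof.
apply/funext => h; apply/funext => b.
by rewrite /killed_step /exit_prob /one /letter_weight; case: h => [|h]; ring.
Qed.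

Let time_step : time = (fun h b => killed_step p time h b + one h b).
Proof.
apply/funext => h; apply/funext => b.
have -> : killed_step p time = killed_step p (fun h b => 0 * height h b ^+ 2 + mu^-1 * height h b).
  by congr (killed_step p _); apply/funext => h'; apply/funext => b'; rewrite mul0r add0r.
by rewrite killed_step_quadratic /time /one; field; rewrite gt_eqF.
Qed.

Let lyapunov_step h b : killed_step p lyapunov h b + time h b <= lyapunov h b.
Proof.
rewrite killed_step_quadratic /time /lyapunov -subr_ge0.
set s := if b then _ else _.
have -> : (2 * mu ^+ 2)^-1 * height h b ^+ 2 +
    (2 * mu ^+ 3)^-1 * (g ^+ 2 + 1) * height h b -
    ((2 * mu ^+ 2)^-1 * (height h b ^+ 2 - 2 * mu * height h b + s) +
     (2 * mu ^+ 3)^-1 * (g ^+ 2 + 1) * (height h b - mu) +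
     mu^-1 * height h b) = (2 * mu ^+ 2)^-1 * (g ^+ 2 + 1 - s).
  by field; rewrite gt_eqF.
apply: mulr_ge0; first by rewrite invr_ge0; apply: mulr_ge0 => //; exact: sqr_ge0.
have g2 := sqr_ge0 g; rewrite {}/s; have := p01 b.
case: b => /= /andP[pb0 pb1].
  by have := mulr_ge0 pb0 g2; nra.
by have := mulr_ge0 (_ : 0 <= 1 - p false) g2; rewrite subr_ge0 => /(_ pb1); nra.
Qed.

Let time_ge0 h b : 0 <= time h b.
Proof. by rewrite mulr_ge0 ?invr_ge0 ?ltW. Qed.

Let lyapunov_ge0 h b : 0 <= lyapunov h b.
Proof.
have mu0 n : 0 <= (2 * mu ^+ n)^-1 by rewrite invr_ge0 mulr_ge0 // exprn_ge0 // ltW.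
apply: addr_ge0; first exact: mulr_ge0 (mu0 2) (sqr_ge0 _).
apply: mulr_ge0 (ltW (height_gt0 h b)); apply: mulr_ge0 (mu0 3) _.
exact: addr_ge0 (sqr_ge0 g) ler01.
Qed.

Let iterSK n f : K n.+1 f = K n (killed_step p f).
Proof. exact: iterSr. Qed.

Let iter_one n h b : K n one h b = K n.+1 one h b + K n (exit_prob p) h b.
Proof. by rewrite iterSK -iter_killed_stepD -one_step. Qed.

Let iter_time n h b : K n time h b = K n.+1 time h b + K n one h b.
Proof. by rewrite iterSK -iter_killed_stepD -time_step. Qed.

Let iter_one_ge0 n h b : 0 <= K n one h b.
Proof. by apply: iter_killed_step_ge0 => *; exact: ler01. Qed.

Let iter_time_le n h b : K n.+1 time h b <= K n time h b.
Proof. by rewrite [leRHS]iter_time lerDl. Qed.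

Let iter_lyapunov n h b : K n.+1 lyapunov h b + K n time h b <= K n lyapunov h b.
Proof. by rewrite iterSK -iter_killed_stepD; exact: iter_killed_step_le. Qed.

(** Optional stopping after [n] steps: [K m (exit_prob p)] is the probability of being killed at
    step [m + 1], [K n one] that of surviving [n] steps, [K n time] the expected remaining time of
    the survivors. *)
Lemma sum_exit_prob n h b :
  \sum_(0 <= m < n) m.+1%:R * K m (exit_prob p) h b + n%:R * K n one h b + K n time h b =
  time h b.
Proof.
elim: n => [|n IHn]; first by rewrite big_nil mul0r !add0r.
rewrite big_nat_recr // -[RHS]IHn (iter_time n) (iter_one n) mulrS.
by rewrite /=; ring.
Qed.

(* [K n time] is nonincreasing in [n] and its sum over [n] is at most
   [lyapunov], hence it is [O(1/n)]; the tail [n * K n one] is controlled by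
   [K n./2 time]. *)
Lemma exit_remainder n h b :
  n.+1%:R * (n%:R * K n one h b + K n time h b) <= 6 * (lyapunov h b + time h b).
Proof.
have sum_time m : m%:R * K m time h b + K m lyapunov h b <= lyapunov h b.
  elim: m => [|m IHm]; first by rewrite mul0r add0r.
  have := iter_lyapunov m h b; have := iter_time_le m h b.
  by move: IHm; rewrite mulrS; have : 0 <= m%:R :> R by []; nra.
(* Each step costs the survival probability, which never increases, so [k] steps cost at least [k]
   times its final value. *)
have sum_one m k : k%:R * K (m + k) one h b + K (m + k) time h b <= K m time h b.
  elim: k => [|k IHk]; first by rewrite addn0 mul0r add0r.
  move: IHk; rewrite addnS (iter_time (m + k)) (iter_one (m + k)) mulrS.
  have : 0 <= K (m + k) (exit_prob p) h b.
    by apply: iter_killed_step_ge0 => -[|h'] b'; [exact: letter_weight_ge0 | exact: lexx].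
  have : 0 <= k%:R :> R by [].
  by nra.
have time_m0 m : 0 <= K m time h b by exact: iter_killed_step_ge0.
have := sum_one n./2 (n - n./2)%N.
have -> : (n./2 + (n - n./2) = n)%N by lia.
have nE : n%:R <= 2 * (n - n./2)%:R :> R by rewrite -natrM ler_nat; lia.
have n1E : n.+1%:R <= 2 * n./2.+1%:R :> R by rewrite -natrM ler_nat; lia.
move=> sum_n.
have bound : n%:R * K n one h b + K n time h b <= 3 * K n./2 time h b.
  have := iter_one_ge0 n h b; have := time_m0 n; have := time_m0 n./2.
  by have : 0 <= (n - n./2)%:R :> R by []; nra.
have half : n./2.+1%:R * K n./2 time h b <= lyapunov h b + time h b.
  have : K n./2 time h b <= time h b.
    by elim: n./2 => // m IHm; exact: le_trans (iter_time_le _ _ _) IHm.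
  have := sum_time n./2.
  have : 0 <= K n./2 lyapunov h b by exact: iter_killed_step_ge0.
  by rewrite mulrS; lra.
apply: (@le_trans _ _ (n.+1%:R * (3 * K n./2 time h b))).
  by apply: ler_wpM2l.
apply: (@le_trans _ _ (2 * n./2.+1%:R * (3 * K n./2 time h b))).
  by apply: ler_wpM2r; rewrite ?mulr_ge0.
by rewrite (_ : _ * _ = 6 * (n./2.+1%:R * K n./2 time h b)); [apply: ler_wpM2l | ring].
Qed.

Lemma cvg_sum_exit_prob b :
  (fun n => \sum_(0 <= m < n) m.+1%:R * K m (exit_prob p) 0 b) @ \oo --> time 0 b.
Proof.
set c := 6 * (lyapunov 0 b + time 0 b).
have cvgc : time 0 b - c * n.+1%:R^-1 @[n --> \oo] --> time 0 b.
  rewrite -[X in _ --> X]subr0 -(mulr0 c).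
  by apply: cvgB; [exact: cvg_cst | apply: cvgMr; exact: cvg_harmonic].
apply: (squeeze_cvgr _ cvgc (cvg_cst _)); apply: nearW => n.
have := exit_remainder n 0 b; rewrite -/c.
have := sum_exit_prob n 0 b.
set s := \sum_(_ <= _ < _) _ => <- rem_le; apply/andP; split.
  by rewrite lerBlDr -addrA lerD2l ler_pdivlMr // mulrC.
by rewrite -addrA lerDl addr_ge0 ?mulr_ge0 //; exact: iter_killed_step_ge0.
Qed.

End FirstPassage.

(** * The mean length of an excursion *)

Fixpoint words (n : nat) : seq (seq bool) :=
  if n is n'.+1 then
    [seq true :: w | w <- words n'] ++ [seq false :: w | w <- words n']
  else [:: [::]].

Lemma mem_words n w : (w \in words n) = (size w == n).
Proof.
elim: n w => [|n IHn] [|b w] //=.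
  by rewrite mem_cat; apply/negbTE; rewrite negb_or; apply/andP; split; apply/mapP => -[].
have consI c : injective (cons c : seq bool -> seq bool) by move=> ? ? [].
rewrite eqSS -IHn mem_cat; case: b; rewrite (mem_map (consI _)).
  by rewrite orbC; case: mapP => // -[].
by case: mapP => // -[].
Qed.

Lemma words_uniq n : uniq (words n).
Proof.
elim: n => //= n IHn; rewrite cat_uniq !map_inj_uniq ?IHn /=; try by move=> ? ? [].
by rewrite andbT; apply/hasPn => _ /mapP[w _ ->]; apply/mapP => -[].
Qed.

(** Reading a letter is one [killed_step]; the empty word carries the final down-step, which must
    start from height 0. *)
Lemma sum_word_weight {R : pzRingType} (p : bool -> R) n h b :
  \sum_(w <- words n | ballot h w == Some 0%N) word_weight p b w =
  iter n (killed_step p) (exit_prob p) h b.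
Proof.
elim: n h b => [|n IHn] h b; first by rewrite /= big_mkcond big_seq1; case: h.
rewrite /= big_cat !big_map /= /killed_step -IHn -big_distrr /=; congr (_ + _).
case: h => [|h]; first by rewrite big_pred0_eq mulr0.
by rewrite -IHn big_distrr.
Qed.

Section Excursions.
Local Open Scope classical_set_scope.
Local Open Scope ring_scope.

(** Excursions are grouped by length; dropping the first letter is injective because that letter is
    always 0. *)
Lemma esum_excursion {R : realType} (F : seq bool -> \bar R) :
  (forall w, 0 <= F w)%E ->
  (\esum_(e in [set: excursion]) F (behead (val e)) =
   \sum_(n <oo) \sum_(w <- words n | ballot 0 w == Some 0%N) F w)%E.
Proof.
move=> F0; rewrite nneseries_esumT; last by move=> n; exact: sume_ge0.
pose J n := [set` [seq w <- words n | ballot 0 w == Some 0%N]].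
transitivity (\esum_(n in setT) \esum_(w in J n) F w)%E; last first.
  apply: eq_esum => n _; rewrite esum_fset //; last exact: finite_seq.
  by rewrite -fsbig_seq ?filter_uniq ?words_uniq // big_filter.
rewrite -esum_bigcupT //; last first.
  by move=> i j _ _ [w []]; rewrite /J /= !mem_filter !mem_words => /andP[_ /eqP <-] /andP[_ /eqP].
apply/esym/reindex_esum; split.
- move=> [[|b w] //= wexc] _; have := wexc; rewrite is_excursionE => /andP[_ wdyck].
  by exists (size w) => //; rewrite /J /= mem_filter wdyck mem_words /=.
- move=> [[|b w] //= bw] [[|b' w'] //= bw'] _ _ ww'; apply: val_inj => /=.
  by move: bw bw'; rewrite !is_excursionE ww' => /andP[/negbTE-> _] /andP[/negbTE-> _].
- move=> w [n _]; rewrite /J /= mem_filter => /andP[wdyck _].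
  have wexc : is_excursion (false :: w) by rewrite is_excursionE.
  by exists (Sub (false :: w) wexc : excursion).
Qed.

Lemma mean_lengthE {R : realType} (q : nat -> R) (c d : R) :
  0 <= c < 1 -> 0 <= d < 1 ->
  (forall k, (1 <= k)%N ->
    q k = c ^+ k.-1 * d * (1 - c) ^+ 2 / (1 - c ^+ k * d) ^+ 2) ->
  mean_length q = (1 + d) / (1 - d).
Proof.
move=> c01 d01 qE; set p := next_one c d.
have cd1 : 0 < 1 - c * d by have := one_sub_exprM_gt0 c d 1 c01 d01; rewrite expr1.
have /andP[c0 c1] := c01; have /andP[d0 d1] := d01.
have p01 b : 0 <= p b <= 1.
  rewrite /p /next_one ler_pdivrMr // mul1r.
  by rewrite divr_ge0 ?(ltW cd1) //=; case: b; nra.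
(* The solution of the two drift equations for [next_one]. The start has corrected height 1, hence
   expected time [mu^-1]. *)
set mu := (1 - d) / (1 + d); set g := (1 + c) * (1 - d) / ((1 + d) * (1 - c)).
have d1' : 0 < 1 + d by lra.
have c1' : 0 < 1 - c by lra.
have mu_gt0 : 0 < mu by rewrite divr_gt0 // subr_gt0.
have g_gt0 : 0 < g by rewrite divr_gt0 // mulr_gt0 //; lra.
have cvg_time := cvg_sum_exit_prob _ p g mu p01 g_gt0 mu_gt0.
have {}cvg_time := cvg_time _ _ false.
have timeE : mu^-1 * (0%:R + 1) = (1 + d) / (1 - d) by rewrite add0r mulr1 invf_div.
rewrite /mean_length -[RHS]/(fine ((1 + d) / (1 - d))%:E) -timeE; congr fine.
pose F w : \bar R := ((size w).+1%:R * word_weight p false w)%:E.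
transitivity (\esum_(e in [set: excursion]) F (behead (val e)))%E.
  apply: eq_esum => e _; rewrite (phi_weightE _ _ _ _ c01 d01 qE) /F; congr (_%:R * _)%:E.
  by case: e => -[].
rewrite esum_excursion; last first.
  by move=> w; rewrite lee_fin mulr_ge0 // word_weight_ge0.
apply/cvg_lim => //.
rewrite (_ : (fun _ => _) = EFin \o
    (fun n => \sum_(0 <= m < n) m.+1%:R * iter m (killed_step p) (exit_prob p) 0%N false)).
  apply: cvg_EFin; first exact: nearW.
  apply: cvg_time; rewrite /p /next_one /g /mu; field.
    by rewrite !gt_eqF.
  by rewrite !gt_eqF.
apply/funext => n; rewrite /= -sumEFin; apply: eq_bigr => m _.
rewrite -sum_word_weight big_distrr /= -sumEFin big_seq_cond [RHS]big_seq_cond.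
by apply: eq_bigr => w /andP[]; rewrite mem_words => /eqP <-.
Qed.

End Excursions.

(** * Solving the linear system for the velocities *)

Theorem proposition5p24 (R : realType)
    (veff : nat -> (nat -> R) -> R)
    (hspeed : average_speed_property veff)
    (hsystem : velocity_system veff)
    (q : nat -> R) (c d : R)
    (hc : 0 <= c < 1) (hd : 0 < d < 1)
    (hq : Qplus q)
    (hqE : forall k : nat, (1 <= k)%N ->
       q k = c ^+ k.-1 * d * (1 - c) ^+ 2 / (1 - c ^+ k * d) ^+ 2)
    (k l : nat) (hk : (1 <= k)%N) (hl : (l <= k)%N) :
  (if (l < k)%N then veff (k - l)%N (theta l q) else 0) =
  (k - l)%:R * ((1 + c ^+ l * d) / (1 - c ^+ l * d)) -
  2 * c ^+ l * d * (1 + c) * (1 - c ^+ (k - l)) /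
    ((1 - c) * (1 - c ^+ l * d) * (1 + c ^+ k * d)).
Proof.
have d01 : 0 <= d < 1 by case/andP: hd => /ltW -> ->.
have /andP[c0 c1] := hc; have /andP[d0 d1] := d01.
(* For [c = 0] the shifted parameter [c ^+ k * d] is 0, a value that [mean_lengthE] allows. *)
have mean : mean_length (theta k q) = (1 + c ^+ k * d) / (1 - c ^+ k * d).
  apply: (mean_lengthE _ c) => //.
    rewrite mulr_ge0 ?exprn_ge0 //=.
    by have := one_sub_exprM_gt0 c d k hc d01; rewrite subr_gt0.
  move=> j j1; rewrite /theta hqE ?addn_gt0 ?j1 // exprD.
  by rewrite (_ : (j + k).-1 = j.-1 + k)%N ?exprD ?mulrA //; lia.
have D_neq0 j : 1 - c ^+ j * d != 0 by rewrite gt_eqF // one_sub_exprM_gt0.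
have D'_neq0 j : 1 + c ^+ j * d != 0.
  by rewrite gt_eqF // ltr_pwDl // mulr_ge0 // exprn_ge0.
have c_neq1 : 1 - c != 0 by rewrite gt_eqF // subr_gt0.
have [rec last_v] := hsystem q k hq hk.
move: rec last_v; rewrite mean invf_div => rec last_v.
rewrite -/(shifted_velocity veff q k l).
set v := shifted_velocity veff q k in rec last_v *.
(* The closed formula with [i] in place of [k - m], which keeps truncated subtraction out of the
   algebra. *)
pose u m i : R := i%:R * ((1 + c ^+ m * d) / (1 - c ^+ m * d)) -
  2 * c ^+ m * d * (1 + c) * (1 - c ^+ i) /
    ((1 - c) * (1 - c ^+ m * d) * (1 + c ^+ k * d)).
(* The recursion has order two, so two consecutive values are carried downwards. *)
suff down i m : (m + i.+1 = k)%N -> v m = u m i.+1 /\ v m.+1 = u m.+1 i.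
  case: (ltnP l k) => lk.
    have lkE : (l + (k - l).-1.+1 = k)%N by lia.
    by have [-> _] := down _ _ lkE; rewrite (_ : (k - l).-1.+1 = k - l)%N //; lia.
  have -> : l = k by lia.
  rewrite /v /shifted_velocity ltnn subnn mul0r expr0 subrr mulr0 mul0r subr0 //.
elim: i m => [|i IHi] m mk.
  have mE : k = m.+1 by lia.
  split; last by rewrite -mE /v /shifted_velocity ltnn /u mul0r subrr mulr0 mul0r subr0.
  rewrite (_ : m = k.-1) ?last_v; last by rewrite mE.
  (* With [x = c ^+ m * d] this is [(1 + x) * (1 + c * x) - 2 * x * (1 + c) = (1 - x) * (1 - c *
     x)]. *)
  rewrite /u mE /= expr1 exprS.
  have := D_neq0 m; have := D'_neq0 m.+1; rewrite exprS => Dm D'm.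
  by field; rewrite ?c_neq1 ?Dm ?D'm.
have [v1 v2] := IHi m.+1 ltac:(lia).
split=> //.
have := rec m.+1 ltac:(lia).
rewrite [m.+1.-1]/= v1 v2 -addrA => /eqP; rewrite addr_eq0 => /eqP ->.
have qE : 1 - q m.+1 = (1 - c ^+ m * d) * (1 - c ^+ m.+2 * d) / (1 - c ^+ m.+1 * d) ^+ 2.
  by apply: one_sub_q.
rewrite qE /u; have := D_neq0 m; have := D_neq0 m.+1; have := D_neq0 m.+2.
move: (D'_neq0 k); rewrite -mk !exprS exprD !exprS !mulrSr => D'k D2 D1 D0.
by field; rewrite ?c_neq1 ?D0 ?D1 ?D2 ?D'k.
Qed.
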